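(* Let $f,h:X\to\mathbb{R}\cup\{\infty\}$ satisfy the standing assumptions in the context. Suppose $\gamma>1$ is such that $f$ has $\gamma$-curvature relative to $h$ with constant $C$ (defined in the context). Let $(x_k,u_k,s_k)$, $k=0,1,2,\dots$, be the iterates generated by the generalized conditional subgradient algorithm (defined in the context), where $\alpha_0=1$ and for $k=1,2,\dots$ the step size $\alpha_k\in[0,1]$ is chosen by the line search $$\alpha_k\in\operatorname*{argmin}_{\alpha\in[0,1]}\bigl\{(1-\alpha)\,G_k+D_f(x_k+\alpha(s_k-x_k),x_k)\bigr\},$$ with $G_1=D_f(s_0,x_0)$ and $G_{k+1}=(1-\alpha_k)G_k+D_f((1-\alpha_k)x_k+\alpha_ks_k,x_k)$ for $k=1,2,\dots$. Then for all $k=1,2,\dots$ $$f(x_k)+h(x_k)+f^*(\hat u_k)+h^*(-\hat u_k)\le C\left(\frac{\gamma}{k+\gamma}\right)^{\gamma-1},$$ where $\hat u_k$ is either of the following: $\hat u_k=\sum_{i=0}^{k-1}\lambda_i^ku_i$, or $\hat u_k$ is an element of $\{u_0,\dots,u_{k-1}\}$ minimizing $f^*(u_i)+h^*(-u_i)$.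
   Context: Setting. $X$ is a finite-dimensional real vector space with dual $X^*$ and pairing $\langle\cdot,\cdot\rangle$. $f,h:X\to\mathbb{R}\cup\{\infty\}$ are proper closed convex functions with Fenchel conjugates $f^*,h^*:X^*\to\mathbb{R}\cup\{\infty\}$. $\operatorname{dom}(\partial f)\subseteq X$ and $\operatorname{dom}(\partial h^* )\subseteq X^*$ are the sets of points at which the respective subdifferential is nonempty. Single-valued oracles are fixed: for each $y\in\operatorname{dom}(\partial f)$, $\partial f(y)\in X^*$ denotes one fixed chosen element of $\operatorname{argmax}_{v\in X^*}\{\langle v,y\rangle-f^*(v)\}$ (the subdifferential of $f$ at $y$); for each $u\in\operatorname{dom}(\partial h^* )$, $\partial h^*(u)\in X$ denotes one fixed chosen element of $\operatorname{argmax}_{x\in X}\{\langle u,x\rangle-h(x)\}$ (the subdifferential of $h^*$ at $u$). Standing assumption: $-\partial f(y)\in\operatorname{dom}(\partial h^* )$ for all $y\in\operatorname{dom}(\partial f)$, and $\partial h^*(u)\in\operatorname{dom}(\partial f)$ for all $u\in\operatorname{dom}(\partial h^* )$. Generalized Bregman distance: $D_f(y,x)=f(y)-f(x)-\langle\partial f(x),y-x\rangle$ for $x\in\operatorname{dom}(\partial f)$, $y\in\operatorname{dom}(f)$, with the chosen subgradient $\partial f(x)$. Relative $\gamma$-curvature: $f$ has $\gamma$-curvature relative to $h$ with (finite) constant $C$ if for all $x\in\operatorname{dom}(\partial f)$ and $v\in\operatorname{dom}(\partial h^* )$, with $s=\partial h^*(v)$, one has $D_f(x+\alpha(s-x),x)\le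 C\alpha^\gamma/\gamma$ for all $\alpha\in[0,1]$. Generalized conditional subgradient algorithm: given $x_0\in\operatorname{dom}(\partial f)$, for $k=0,1,2,\dots$: $u_k:=\partial f(x_k)$, $s_k:=\partial h^*(-u_k)$, pick $\alpha_k\in[0,1]$, $x_{k+1}:=(1-\alpha_k)x_k+\alpha_ks_k$. The iterates are understood to be well defined, i.e. $x_k\in\operatorname{dom}(\partial f)$ for all $k$. Weights: for $k=0,1,2,\dots$, $\lambda^{k+1}_k=\alpha_k$ and $\lambda^{k+1}_i=(1-\alpha_k)\lambda^k_i$ for $i=0,\dots,k-1$. *)

(* Defs.v *)
From HB Require Import structures.
From mathcomp Require Export all_boot all_order all_algebra.
From mathcomp Require Export all_classical all_reals all_analysis.
Export numFieldNormedType.Exports.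

Set Implicit Arguments.
Unset Strict Implicit.
Unset Printing Implicit Defensive.

Import Order.TTheory GRing.Theory Num.Theory.
Local Open Scope classical_set_scope.
Local Open Scope ring_scope.
Local Open Scope ereal_scope.

Definition argmin (R : realType) (T : Type) (A : set T) (phi : T -> \bar R) :
    set T :=
  [set a | A a /\ forall b, A b -> phi a <= phi b].

Definition argmax (R : realType) (T : Type) (A : set T) (phi : T -> \bar R) :
    set T :=
  [set a | A a /\ forall b, A b -> phi b <= phi a].

Section ConvexFunctions.
Variables (R : realType) (X : vectType R).
Implicit Types (f h : X -> \bar R) (x y : X) (u v : 'Hom(X, R^o)).

Definition pairing v x : R := v x.

Definition epigraph f : set (X * R^o)%type := [set p | f p.1 <= (p.2 : R)%:E].

(* An abstract vectType carries no topology: the canonical topology of a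
   finite-dimensional space is read in the coordinates of a basis (every basis
   gives the same closed sets). *)
Definition closed_fun f : Prop :=
  closed [set p : 'rV[R]_(\dim {:X}) * R |
            epigraph f (passmx.vecof (vbasis {:X}) p.1, p.2)].

Definition proper_fun f : Prop :=
  (forall x, f x != -oo) /\ (exists x, f x != +oo).

Definition proper_closed_convex f : Prop :=
  [/\ proper_fun f, closed_fun f & convex_set (epigraph f)].

Definition fenchel_conj f : 'Hom(X, R^o) -> \bar R :=
  fun v => ereal_sup [set (pairing v x)%:E - f x | x in [set: X]].

Definition subdiff f y : set 'Hom(X, R^o) :=
  argmax [set: 'Hom(X, R^o)] (fun v => (pairing v y)%:E - fenchel_conj f v).

(* Subdifferential of h^* at u, as a subset of X rather than of its bidual. *)
Definition subdiff_conj h u : set X :=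
  argmax [set: X] (fun x => (pairing u x)%:E - h x).

Definition dom_subdiff f : set X := [set y | subdiff f y !=set0].

Definition dom_subdiff_conj h : set 'Hom(X, R^o) :=
  [set u | subdiff_conj h u !=set0].

(* The oracles are total functions whose values matter only on the domains of
   the subdifferentials. *)
Definition subgrad_oracle f (df : X -> 'Hom(X, R^o)) : Prop :=
  forall y, dom_subdiff f y -> subdiff f y (df y).

Definition subgrad_conj_oracle h (dhs : 'Hom(X, R^o) -> X) : Prop :=
  forall u, dom_subdiff_conj h u -> subdiff_conj h u (dhs u).

Definition compatible_oracles f h (df : X -> 'Hom(X, R^o))
    (dhs : 'Hom(X, R^o) -> X) : Prop :=
  (forall y, dom_subdiff f y -> dom_subdiff_conj h (- df y)%R) /\
  (forall u, dom_subdiff_conj h u -> dom_subdiff f (dhs u)).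

(* Meaningful for x in dom_subdiff f and f y finite. *)
Definition bregman f (df : X -> 'Hom(X, R^o)) y x : \bar R :=
  f y - f x - (pairing (df x) (y - x)%R)%:E.

Definition has_curvature f h (df : X -> 'Hom(X, R^o))
    (dhs : 'Hom(X, R^o) -> X) (gamma C : R) : Prop :=
  forall x v, dom_subdiff f x -> dom_subdiff_conj h v ->
  forall a : R, (0 <= a <= 1)%R ->
  bregman f df (x + a *: (dhs v - x))%R x <= (C * a `^ gamma / gamma)%:E.

(* The last clause is the requirement that the iterates be well defined. *)
Definition gcs_iterates f (df : X -> 'Hom(X, R^o)) (dhs : 'Hom(X, R^o) -> X)
    (alpha : nat -> R) (x : nat -> X) (u : nat -> 'Hom(X, R^o))
    (s : nat -> X) : Prop :=
  [/\ forall k, u k = df (x k),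
      forall k, s k = dhs (- u k)%R,
      forall k, (0 <= alpha k <= 1)%R,
      forall k, x k.+1 = ((1 - alpha k) *: x k + alpha k *: s k)%R
    & forall k, dom_subdiff f (x k)].

End ConvexFunctions.

Definition gcs_weights (R : realType) (alpha : nat -> R)
    (lam : nat -> nat -> R) : Prop :=
  (forall k, lam k.+1 k = alpha k) /\
  (forall k i, (i < k)%N -> lam k.+1 i = ((1 - alpha k) * lam k i)%R).

(* Main.v *)
(* With c_i = f^*(u_i) + h^*(-u_i), induction on k gives
   f(x_k) + h(x_k) + sum_(i < k) lam^k_i c_i <= G_k: f(x_(k+1)) and
   h(x_(k+1)) are controlled by the definition of D_f and by the convexity of h,
   and the equality cases of Fenchel-Young turn c_k into <u_k, x_k - s_k> - f(x_k)
   - h(s_k).  Both choices of uhat have dual value at most sum_i lam^k_i c_i.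
   The rate G_k <= C t^(gamma - 1), t = gamma / (k + gamma), follows by trying the
   step t in the line search.  The equality f(x_k) = <u_k, x_k> - f^*(u_k) for an
   argmax u_k needs f = f^**, which is obtained by projecting a point below the
   graph onto the closed convex epigraph. *)
Require Import Defs.
From mathcomp Require Import all_boot all_order all_algebra.
From mathcomp Require Import all_classical all_reals all_analysis.
From mathcomp Require Import ring lra.
Set Implicit Arguments.
Unset Strict Implicit.
Unset Printing Implicit Defensive.

Import Order.TTheory GRing.Theory Num.Theory.
Import numFieldNormedType.Exports.
Local Open Scope classical_set_scope.
Local Open Scope ring_scope.
Local Open Scope ereal_scope.

(** * Projection onto a closed convex set in coordinates *)

(** Replaces letting [t] tend to 0 in a first-order condition: a positive [b] is refuted at
    [t = b / (2 * b + q)], where [t * q < b]. *)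
Lemma le0_of_small_multiples (R : realType) (b q : R) : (0 <= q)%R ->
  (forall t : R, (0 < t <= 1)%R -> (b <= t * q)%R) -> (b <= 0)%R.
Proof.
move=> q0 H; rewrite leNgt; apply/negP => b0.
have bq : (0 < 2 * b + q)%R by lra.
have /H : (0 < b / (2 * b + q) <= 1)%R.
  by rewrite divr_gt0//= ler_pdivrMr// mul1r; lra.
rewrite mulrAC ler_pdivlMr// => Hb.
suff : (0 < b * b)%R by nra.
by rewrite mulr_gt0.
Qed.

(** Squared Euclidean distance. The norm carried by this product is a max norm, which comes from no
    inner product, so obtuse angles are read off this sum of squares. *)
Definition sqdist (R : realType) n (p q : 'rV[R]_n * R) : R :=
  (\sum_i (p.1 0 i - q.1 0 i) ^+ 2 + (p.2 - q.2) ^+ 2)%R.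

Lemma sqdist_ge0 (R : realType) n (p q : 'rV[R]_n * R) : (0 <= sqdist p q)%R.
Proof. by rewrite addr_ge0 ?sqr_ge0// sumr_ge0// => i _; rewrite sqr_ge0. Qed.

Lemma continuous_sqdist (R : realType) n (q : 'rV[R]_n * R) :
  continuous (fun p => sqdist p q).
Proof.
move=> p; rewrite /sqdist; apply: cvgD.
  apply: cvg_big => /=.
    exact: add_continuous.
  move=> i _.
    have ci : (fun p : 'rV[R]_n * R => (p.1 0 i - q.1 0 i)%R) p'
         @[p' --> p] --> (p.1 0 i - q.1 0 i)%R.
      apply: cvgB; last exact: cvg_cst.
      apply: (@continuous_comp _ _ _ fst (fun M : 'rV[R]_n => M 0%R i)).
        exact: cvg_fst.
      exact: coord_continuous.
    exact: (cvgM ci ci).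
have c2 : (fun p : 'rV[R]_n * R => (p.2 - q.2)%R) p' @[p' --> p]
     --> (p.2 - q.2)%R by apply: cvgB; [exact: cvg_snd|exact: cvg_cst].
exact: (cvgM c2 c2).
Qed.

(** [A] may be unbounded, but every point at least as close to [q] as [a0] lies in the compact box
    [K], so the minimum over [K] and [A] together is global. *)
Lemma nearest_point (R : realType) n (A : set ('rV[R]_n * R))
    (q : 'rV[R]_n * R) :
  closed A -> A !=set0 ->
  exists2 p, A p & forall a, A a -> (sqdist p q <= sqdist a q)%R.
Proof.
move=> clA [a0 Aa0]; pose M := (1 + sqdist a0 q)%R.
have M1 : (1 <= M)%R by rewrite lerDl sqdist_ge0.
pose box (m : R) : set R := `[(m - M)%R, (m + M)%R]%classic.
pose K := [set v : 'rV[R]_n | forall i, box (q.1 0 i)%R (v ord0 i)] `*` box q.2.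
(* The radius [M] avoids a square root, thanks to [|z| <= 1 + z ^+ 2]. *)
have sq_le (m c : R) : ((c - m) ^+ 2 <= sqdist a0 q)%R -> box m c.
  rewrite /box /= in_itv/= => H.
  have SM : sqdist a0 q = (M - 1)%R by rewrite /M addrC addKr.
  have := sqr_ge0 (c - m - 1); have := sqr_ge0 (c - m + 1).
  by rewrite SM in H => H1 H2; apply/andP; split; nra.
have inK a : (sqdist a q <= sqdist a0 q)%R -> K a.
  move=> aq; split => /= [i|]; apply: sq_le; apply: le_trans aq.
    rewrite /sqdist (bigD1 i)//= -addrA lerDl addr_ge0 ?sqr_ge0//.
    by rewrite sumr_ge0// => j _; rewrite sqr_ge0.
  by rewrite lerDr sumr_ge0// => j _; rewrite sqr_ge0.
have cptK : compact K.
  apply: compact_setX; last exact: segment_compact.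
  by apply: (@rV_compact _ _ (fun i => box (q.1 0 i)%R)) => i; exact: segment_compact.
have cptAK : compact (K `&` A) by exact: compact_closedI.
have [||p /set_mem[Kp Ap] pmin] := @compact_EVT_min _ _ (fun p => sqdist p q) _ _ cptAK.
- by exists a0; split => //; exact: inK.
- by apply: continuous_subspaceT => x; exact: continuous_sqdist.
exists p => // a Aa.
have [aq|/ltW aq] := leP (sqdist a q) (sqdist a0 q).
  by apply: pmin; apply/mem_set; split => //; exact: inK.
by apply: le_trans aq; apply: pmin; apply/mem_set; split => //; exact: inK.
Qed.

(** Moving from the nearest point [p] towards [a] by [t] changes the squared distance to [q] by
    [t * (t * sqdist a p - 2 * s)], with [s] the inner product in question. Minimality makes this
    nonnegative for all small [t]. *)
Lemma projection_obtuse (R : realType) n (A : set ('rV[R]_n * R))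
    (q : 'rV[R]_n * R) :
  closed A -> A !=set0 ->
  (forall a b (t : R), A a -> A b -> (0 <= t <= 1)%R ->
    A ((t *: a.1 + (1 - t) *: b.1)%R, (t * a.2 + (1 - t) * b.2)%R)) ->
  exists2 p, A p & forall a, A a ->
    (\sum_i (a.1 0 i - p.1 0 i) * (q.1 0 i - p.1 0 i)
      + (a.2 - p.2) * (q.2 - p.2) <= 0)%R.
Proof.
move=> clA A0 cvxA; have [p Ap pmin] := nearest_point q clA A0.
exists p => // a Aa.
set s := (X in (X <= 0)%R).
suff : (2 * s <= 0)%R by lra.
apply: (@le0_of_small_multiples _ _ (sqdist a p)); first exact: sqdist_ge0.
move=> t /andP[t0 t1].
have /pmin : A ((t *: a.1 + (1 - t) *: p.1)%R, (t * a.2 + (1 - t) * p.2)%R).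
  by apply: cvxA => //; rewrite ltW.
rewrite -subr_ge0.
have -> : (sqdist ((t *: a.1 + (1 - t) *: p.1), (t * a.2 + (1 - t) * p.2)) q
    - sqdist p q = t * (t * sqdist a p - 2 * s))%R.
  rewrite /sqdist /s /= [in LHS]opprD addrACA -sumrB.
  rewrite !(mulrDr _ (\sum_(i < n) _)%R) opprD addrACA mulrDr; congr (_ + _)%R; last by ring.
  rewrite !mulr_sumr -sumrB mulr_sumr; apply: eq_bigr => i _.
  by rewrite !mxE; ring.
by rewrite pmulr_rge0// subr_ge0.
Qed.

(** * Bilinearity of the pairing *)

Section Pairing.
Variables (R : realType) (X : vectType R).
Implicit Types (x y : X) (u v : 'Hom(X, R^o)).

Lemma pairingZl (a : R) v x : pairing (a *: v) x = (a * pairing v x)%R.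
Proof. by rewrite /pairing scale_lfunE. Qed.

Lemma pairingDl u v x : pairing (u + v)%R x = (pairing u x + pairing v x)%R.
Proof. by rewrite /pairing add_lfunE. Qed.

Lemma pairingNl v x : pairing (- v)%R x = (- pairing v x)%R.
Proof. by rewrite /pairing opp_lfunE. Qed.

Lemma pairing_suml n (lam : 'I_n -> R) (u : 'I_n -> 'Hom(X, R^o)) x :
  pairing (\sum_i lam i *: u i)%R x = (\sum_i lam i * pairing (u i) x)%R.
Proof.
by rewrite /pairing sum_lfunE; apply: eq_bigr => i _; rewrite scale_lfunE.
Qed.

Lemma pairingZr (a : R) v x : pairing v (a *: x)%R = (a * pairing v x)%R.
Proof. by rewrite /pairing linearZ. Qed.

Lemma pairingBr v x y : pairing v (x - y)%R = (pairing v x - pairing v y)%R.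
Proof. by rewrite /pairing linearB. Qed.

End Pairing.

(** * Affine minorants of a proper closed convex function *)

Section AffineMinorant.
Variables (R : realType) (X : vectType R) (f : X -> \bar R).
Hypothesis f_pcc : proper_closed_convex f.
Implicit Types (x y : X) (v : 'Hom(X, R^o)).

(** Jensen's inequality with real bounds [a], [b] in place of the values, so that no infinite values
    are added. *)
Lemma epigraph_convex x y (a b t : R) : (0 <= t <= 1)%R ->
  f x <= a%:E -> f y <= b%:E ->
  f (t *: x + (1 - t) *: y)%R <= (t * a + (1 - t) * b)%:E.
Proof.
move=> /andP[t0 t1] fx fy; case: f_pcc => _ _ cvx.
have t01 : Itv.spec (@Itv.num_sem R) (Itv.Real `[0, 1]%Z) t.
  by rewrite /Itv.spec/= /Itv.num_sem num_real/= in_itv/= t0.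
have := cvx (x, a) (y, b) (Itv.mk t01) (mem_set fx) (mem_set fy).
by move=> /set_mem.
Qed.

Lemma proper_exists : exists x (a : R), f x = a%:E.
Proof.
case: f_pcc => -[fNy [x fx]] _ _; exists x, (fine (f x)).
by rewrite fineK// fin_numE fx andbT; exact: fNy.
Qed.

(** The hyperplane through the projection [(z, r)] of [(y, c)] onto the epigraph, orthogonal to
    their difference. The vertical coefficient [d = r - c] may vanish. *)
Lemma epigraph_separation y (c : R) : c%:E < f y ->
  exists v (b d : R), [/\ (0 <= d)%R,
    forall x (t : R), f x <= t%:E -> (pairing v x + b <= d * t)%R &
    (d * c < pairing v y + b)%R].
Proof.
move=> cfy; have [_ clf _] := f_pcc.
set e := vbasis {:X}; have be : basis_of {:X} e := vbasisP _.
have vecofD (t t' : R) p q : passmx.vecof e (t *: p + t' *: q)%R =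
    (t *: passmx.vecof e p + t' *: passmx.vecof e q)%R.
  rewrite /passmx.vecof !scaler_sumr -big_split; apply: eq_bigr => i _.
  by rewrite !mxE scalerDl !scalerA.
pose A := [set p : 'rV[R]_(\dim {:X}) * R |
            epigraph f (passmx.vecof e p.1, p.2)].
have AE x (t : R) : f x <= t%:E -> A (passmx.rVof e x, t).
  by rewrite /A /epigraph /= passmx.rVofK.
have [x0 [a0 fx0]] := proper_exists.
have [|||[z r] Azr sep] := @projection_obtuse R _ A (passmx.rVof e y, c).
- exact: clf.
- by exists (passmx.rVof e x0, a0); apply: AE; rewrite fx0.
- move=> a b t Aa Ab t01; rewrite /A /epigraph/= vecofD.
  exact: epigraph_convex.
pose w i := (passmx.rVof e y 0 i - z 0 i)%R.
pose v : 'Hom(X, R^o) := (\sum_i w i *: linfun (coord e i : X -> R^o))%R.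
have vE x : pairing v x = (\sum_i passmx.rVof e x 0 i * w i)%R.
  rewrite /pairing /v sum_lfunE; apply: eq_bigr => i _.
  by rewrite scale_lfunE lfunE/= mxE mulrC.
(* Chosen so that [pairing v x + b - (r - c) * t] vanishes at [(z, r)]. *)
pose b := ((r - c) * r - \sum_i z 0 i * w i)%R.
have vb x (t : R) : (pairing v x + b - (r - c) * t =
    \sum_i (passmx.rVof e x 0 i - z 0 i) * w i + (t - r) * (c - r))%R.
  have -> : (\sum_i (passmx.rVof e x 0 i - z 0 i) * w i
      = pairing v x - \sum_i z 0 i * w i)%R.
    by rewrite vE -sumrB; apply: eq_bigr => i _; rewrite mulrBl.
  by rewrite /b; ring.
have vle x (t : R) : f x <= t%:E -> (pairing v x + b <= (r - c) * t)%R.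
  by move=> /AE/sep/= sep_x; rewrite -subr_le0 vb.
exists v, b, (r - c)%R; split => //.
(* The epigraph is unbounded upwards: were [r - c] negative, the inequality would fail at a high
   enough point [t] above [x0]. *)
- rewrite leNgt; apply/negP => rc0.
  pose t := (Num.max a0 ((pairing v x0 + b - 1) / (r - c)))%R.
  have /vle : f x0 <= t%:E by rewrite fx0 lee_fin le_max lexx.
  apply/negP; rewrite -ltNge.
  have : ((pairing v x0 + b - 1) / (r - c) <= t)%R by rewrite le_max lexx orbT.
  rewrite ler_ndivrMr// => /le_lt_trans.
  by rewrite mulrC; apply; lra.
(* At [(y, c)] the expression in [vb] is the squared distance to [(z, r)]. If it were zero, [(y, c)]
   would lie in the epigraph. *)
- have sq0 i : (0 <= (passmx.rVof e y 0 i - z 0 i) * w i)%R by exact: sqr_ge0.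
  have rc0 : (0 <= (c - r) * (c - r))%R by exact: sqr_ge0.
  suff : (0 < pairing v y + b - (r - c) * c)%R by rewrite subr_gt0.
  rewrite vb lt_neqAle addr_ge0 ?sumr_ge0// andbT.
  apply/negP; rewrite eq_sym paddr_eq0 ?sumr_ge0// => /andP[/eqP s0].
  rewrite mulf_eq0 orbb subr_eq0 => /eqP cr.
  have yz : passmx.rVof e y = z.
    apply/rowP => i; apply/eqP.
    have /psumr_eq0P/(_ s0)/(_ i isT)/eqP := fun i (_ : true) => sq0 i.
    by rewrite mulf_eq0 orbb subr_eq0.
  by move: Azr; rewrite /A /epigraph /= -yz -cr passmx.rVofK// leNgt cfy.
Qed.

(** If [d] is positive, dividing the separating inequality by it suffices. Otherwise a minorant is
    first obtained at a point [x0] where [f] is finite. *)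
Lemma affine_minorant y (c : R) : c%:E < f y ->
  exists v (b : R), (forall x (t : R), f x <= t%:E -> (pairing v x + b <= t)%R) /\
    (c < pairing v y + b)%R.
Proof.
have nonvertical z (a : R) : a%:E < f z -> forall v (b d : R), (0 < d)%R ->
    (forall x (t : R), f x <= t%:E -> (pairing v x + b <= d * t)%R) ->
    (d * a < pairing v z + b)%R ->
  exists v (b : R), (forall x (t : R), f x <= t%:E -> (pairing v x + b <= t)%R) /\
    (a < pairing v z + b)%R.
  move=> az v b d d0 vle va; exists (d^-1 *: v)%R, (d^-1 * b)%R.
  split=> [x t /vle vle_x|]; rewrite pairingZl -mulrDr mulrC.
    by rewrite ler_pdivrMr// [(t * d)%R]mulrC.
  by rewrite ltr_pdivlMr// mulrC.
move=> cy; have [v [b [d [d0 vle vc]]]] := epigraph_separation cy.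
move: d0; rewrite le_eqVlt => /predU1P[d0|d0]; last exact: (nonvertical _ _ cy v b d).
have [x0 [a0 fx0]] := proper_exists.
have a0x : (a0 - 1)%:E < f x0 by rewrite fx0 lte_fin ltrBlDr ltrDl.
have [v0 [b0 [d' [d'0 v0le v0a]]]] := epigraph_separation a0x.
(* Below a finite value the hyperplane cannot be vertical: [d' = 0] would make [pairing v0 x0 + b0]
   both positive and at most 0. *)
have d'gt0 : (0 < d')%R.
  have /v0le : f x0 <= a0%:E by rewrite fx0.
  rewrite lt_neqAle d'0 andbT; case: eqP v0a => // <-; rewrite !mul0r.
  by move=> /lt_le_trans/[apply]; rewrite ltxx.
have [w [e [wle _]]] := nonvertical _ _ a0x _ _ _ d'gt0 v0le v0a.
rewrite -d0 mul0r in vc.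
(* the separating hyperplane is vertical: tilt a minorant by a large multiple of it *)
pose m := (Num.max 0 (1 + c - (pairing w y + e)) / (pairing v y + b))%R.
have m0 : (0 <= m)%R by rewrite divr_ge0 ?(ltW vc)// le_max lexx.
exists (w + m *: v)%R, (e + m * b)%R; split=> [x t xt|].
  rewrite pairingDl pairingZl addrACA -mulrDr.
  have := wle _ _ xt; have := vle _ _ xt; rewrite -d0 mul0r => vx wx.
  have : (m * (pairing v x + b) <= 0)%R by rewrite mulr_ge0_le0.
  by move: wx => /lerD/[apply]; rewrite addr0.
rewrite pairingDl pairingZl addrACA -mulrDr /m divfK ?gt_eqF//.
rewrite -ltrBlDl lt_max; apply/orP; right; lra.
Qed.

End AffineMinorant.

(** * Fenchel conjugates and the equality cases of Fenchel-Young *)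

Section Conjugate.
Variables (R : realType) (X : vectType R).
Implicit Types (f h : X -> \bar R) (x y : X) (u v : 'Hom(X, R^o)).

Lemma fenchel_young f v x : (pairing v x)%:E - f x <= fenchel_conj f v.
Proof. by apply: ereal_sup_ubound; exists x. Qed.

Lemma fenchel_conj_gtNy f v : proper_fun f -> -oo < fenchel_conj f v.
Proof.
case=> fNy [x fx]; apply: lt_le_trans (fenchel_young f v x).
by rewrite -(@fineK _ (f x)) ?ltNyr// fin_numE fx andbT; exact: fNy.
Qed.

(** Convexity of the conjugate: each expression [pairing v x - f x] under the supremum is affine in
    [v]. *)
Lemma fenchel_conj_sum_le f n (lam a : 'I_n -> R) (u : 'I_n -> 'Hom(X, R^o)) :
  proper_fun f -> (forall i, 0 <= lam i)%R -> (\sum_i lam i = 1)%R ->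
  (forall i, fenchel_conj f (u i) <= (a i)%:E) ->
  fenchel_conj f (\sum_i lam i *: u i)%R <= (\sum_i lam i * a i)%:E.
Proof.
move=> [fNy _] lam0 lam1 ua; apply: ge_ereal_sup => _ [x _ <-].
have := fNy x; case fx : (f x) => [r| |] // _; last by rewrite addeNy leNye.
rewrite -EFinB lee_fin pairing_suml -[r]mul1r -lam1 mulr_suml -sumrB.
apply: ler_sum => i _; rewrite -mulrBr ler_wpM2l//.
by rewrite -lee_fin EFinB -fx; exact: le_trans (fenchel_young _ _ _) (ua i).
Qed.

(** Here [x] maximizes the very expression whose supremum is the conjugate. Comparison with a point
    where [h] is finite shows that [h x] is finite. *)
Lemma subdiff_conj_fenchel h u x : proper_fun h -> subdiff_conj h u x ->
  exists hx : R, h x = hx%:E /\ fenchel_conj h u = (pairing u x - hx)%:E.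
Proof.
move=> [hNy [z hz]] [_ xmax].
have hz' : h z \is a fin_num by rewrite fin_numE hz andbT; exact: hNy.
have hx : h x != +oo.
  apply/eqP => hx; have := xmax z I.
  by rewrite hx -(fineK hz').
have hx' : h x \is a fin_num by rewrite fin_numE hx andbT; exact: hNy.
exists (fine (h x)); split; first by rewrite fineK.
apply/eqP; rewrite eq_le; apply/andP; split; last first.
  by rewrite EFinB fineK//; exact: fenchel_young.
by apply: ge_ereal_sup => _ [y _ <-]; rewrite EFinB fineK//; exact: xmax.
Qed.

(** Here [u] maximizes the expression whose supremum is the biconjugate at [y], so affine minorants
    are needed to return to [f y]. *)
Lemma subdiff_fenchel f y u : proper_closed_convex f -> subdiff f y u ->
  exists fy : R, f y = fy%:E /\ fenchel_conj f u = (pairing u y - fy)%:E.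
Proof.
move=> f_pcc [_ umax]; have [fp _ _] := f_pcc.
have conj_le v (b : R) :
    (forall x (t : R), f x <= t%:E -> (pairing v x + b <= t)%R) ->
    fenchel_conj f v <= (- b)%:E.
  move=> vb; apply: ge_ereal_sup => _ [x _ <-].
  have := fp.1 x; case fx : (f x) => [r| |] // _; last by rewrite addeNy leNye.
  have /vb : f x <= r%:E by rewrite fx.
  by rewrite -EFinB lee_fin => H; lra.
have [x0 [a0 fx0]] := proper_exists f_pcc.
(* Some affine minorant has a slope with finite conjugate, and the maximizer [u] does at least as
   well. *)
have fu : fenchel_conj f u \is a fin_num.
  have a0x : (a0 - 1)%:E < f x0 by rewrite fx0 lte_fin ltrBlDr ltrDl.
  have [v [b [/conj_le vb _]]] := affine_minorant f_pcc a0x.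
  rewrite fin_numE gt_eqF ?fenchel_conj_gtNy//=.
  apply/eqP => fu; have := umax v I; rewrite fu.
  by move: vb (fenchel_conj_gtNy v fp); case: (fenchel_conj f v).
set e := fine (fenchel_conj f u).
have ue : fenchel_conj f u = e%:E by rewrite fineK.
(* Otherwise an affine minorant above the level [pairing u y - e] at [y] would have a slope beating
   the maximizer [u]. *)
have fyle : f y <= (pairing u y - e)%:E.
  rewrite leNgt; apply/negP => /(affine_minorant f_pcc)[v [b [/conj_le vb]]].
  rewrite ltNge => /negP; apply; rewrite -lee_fin EFinB -ue.
  apply: le_trans (umax v I); rewrite EFinD leeD2l//.
  by rewrite leeNr -EFinN.
have yfin : f y \is a fin_num.
  rewrite fin_numE fp.1/=.
  by apply/eqP => fy; move: fyle; rewrite fy.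
have yE : f y = (pairing u y - e)%:E.
  apply/eqP; rewrite eq_le fyle/=.
  have := fenchel_young f u y; rewrite ue -(fineK yfin) -EFinB !lee_fin.
  by move=> ?; lra.
by exists (pairing u y - e)%R; split; rewrite ?ue ?subKr.
Qed.

End Conjugate.

(** * The one-step inequality for the rate *)

(** After taking logarithms, [ln (1 + z) <= z] is applied to [(m + 1) / (m + gamma)] and to
    [(m + 1 + gamma) / (m + gamma)]. The bounds [- (gamma - 1) / (m + gamma)] and [gamma - 1] times
    [1 / (m + gamma)] cancel. *)
Lemma power_rate_step (R : realType) (gamma m : R) : (1 < gamma)%R -> (0 <= m)%R ->
  ((gamma / (m + gamma)) `^ (gamma - 1) * ((m + 1) / (m + gamma)) <=
   (gamma / (m + 1 + gamma)) `^ (gamma - 1))%R.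
Proof.
move=> g1 m0.
have g0 : (0 < gamma)%R by lra.
have mg : (0 < m + gamma)%R by lra.
have mg1 : (0 < m + 1 + gamma)%R by lra.
have m1 : (0 < m + 1)%R by lra.
have p1 : (0 < (gamma / (m + gamma)) `^ (gamma - 1))%R by rewrite powR_gt0 ?divr_gt0.
have p2 : (0 < (gamma / (m + 1 + gamma)) `^ (gamma - 1))%R.
  by rewrite powR_gt0 ?divr_gt0.
have p3 : (0 < (m + 1) / (m + gamma))%R by rewrite divr_gt0.
rewrite -ler_ln ?posrE ?(mulr_gt0 p1 p3)// lnM ?posrE// !ln_powR.
rewrite !ln_div ?posrE//.
have H1 : (ln (m + 1) - ln (m + gamma) <= - ((gamma - 1) / (m + gamma)))%R.
  rewrite -ln_div ?posrE//.
  have -> : ((m + 1) / (m + gamma) = 1 + - ((gamma - 1) / (m + gamma)))%R.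
    by field; rewrite gt_eqF.
  by apply: le_ln1Dx; rewrite ltrN2 ltr_pdivrMr// mul1r; lra.
have H2 : (ln (m + 1 + gamma) - ln (m + gamma) <= (m + gamma)^-1)%R.
  rewrite -ln_div ?posrE//.
  have -> : ((m + 1 + gamma) / (m + gamma) = 1 + (m + gamma)^-1)%R.
    by field; rewrite gt_eqF.
  by apply: le_ln1Dx; apply: lt_trans (_ : 0 < _)%R; rewrite ?invr_gt0//; lra.
have : ((gamma - 1) * (ln (m + 1 + gamma) - ln (m + gamma))
    <= (gamma - 1) / (m + gamma))%R by rewrite ler_wpM2l//; lra.
lra.
Qed.

(** * The averaging weights *)

Section Weights.
Variables (R : realType) (alpha : nat -> R) (lam : nat -> nat -> R).
Hypothesis lam_weights : gcs_weights alpha lam.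

Lemma gcs_weights_sumS n (c : nat -> R) :
  (\sum_(i < n.+1) lam n.+1 i * c i =
   (1 - alpha n) * (\sum_(i < n) lam n i * c i) + alpha n * c n)%R.
Proof.
have [lamS lamM] := lam_weights.
rewrite big_ord_recr /= lamS mulr_sumr; congr (_ + _)%R.
by apply: eq_bigr => i _; rewrite lamM// mulrA.
Qed.

(** The full first step gives total weight 1, which each later convex combination preserves. *)
Lemma gcs_weights_sum1 n : alpha 0%N = 1%R -> (\sum_(i < n.+1) lam n.+1 i = 1)%R.
Proof.
move=> alpha0.
under eq_bigr do rewrite -[lam _ _]mulr1.
elim: n => [|n IHn]; rewrite (gcs_weights_sumS _ (fun=> 1%R)).
  by rewrite big_ord0 alpha0 mulr0 add0r mulr1.
by rewrite IHn !mulr1 subrK.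
Qed.

Lemma gcs_weights_ge0 n i : (forall k, 0 <= alpha k <= 1)%R -> (i < n)%N ->
  (0 <= lam n i)%R.
Proof.
have [lamS lamM] := lam_weights => alpha01.
elim: n i => [//|n IHn] i; rewrite ltnS leq_eqVlt => /predU1P[->|lt_in].
  by rewrite lamS; case/andP: (alpha01 n).
by rewrite lamM// mulr_ge0 ?IHn// subr_ge0; case/andP: (alpha01 n).
Qed.

End Weights.

(** * Analysis of the conditional subgradient iterates *)

Section ConditionalSubgradient.
Variables (R : realType) (X : vectType R) (f h : X -> \bar R).
Variables (df : X -> 'Hom(X, R^o)) (dhs : 'Hom(X, R^o) -> X).
Variables (gamma C : R) (alpha : nat -> R) (x : nat -> X).
Variables (u : nat -> 'Hom(X, R^o)) (s : nat -> X) (G : nat -> \bar R).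
Variable lam : nat -> nat -> R.
Hypotheses (f_pcc : proper_closed_convex f) (h_pcc : proper_closed_convex h).
Hypotheses (df_oracle : subgrad_oracle f df)
  (dhs_oracle : subgrad_conj_oracle h dhs).
Hypotheses (df_dhs : compatible_oracles f h df dhs).
Hypotheses (iter : gcs_iterates f df dhs alpha x u s).
Hypothesis alpha0 : alpha 0%N = 1%R.
Hypothesis G1 : G 1%N = bregman f df (s 0%N) (x 0%N).

Let fv k := fine (f (x k)).
Let hv k := fine (h (s k)).
(** [cf k] and [ch k] are the real values that the equality cases give to [fenchel_conj f (u k)] and
    [fenchel_conj h (- u k)]. *)
Let cf k : R := (pairing (u k) (x k) - fv k)%R.
Let ch k : R := (- pairing (u k) (s k) - hv k)%R.

Lemma iterates_f k : f (x k) = (fv k)%:E /\ fenchel_conj f (u k) = (cf k)%:E.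
Proof.
have [uE _ _ _ xdom] := iter.
have [r [fx fu]] := subdiff_fenchel f_pcc (df_oracle (xdom k)).
by rewrite /cf /fv fx uE fu.
Qed.

Lemma dom_conj_iterates k : dom_subdiff_conj h (- u k)%R.
Proof. by have [-> _ _ _ xdom] := iter; exact: df_dhs.1. Qed.

Lemma iterates_h k :
  h (s k) = (hv k)%:E /\ fenchel_conj h (- u k)%R = (ch k)%:E.
Proof.
have [_ sE _ _ _] := iter; have [hp _ _] := h_pcc.
have [r [hs hu]] := subdiff_conj_fenchel hp (dhs_oracle (dom_conj_iterates k)).
by rewrite /ch /hv sE hs hu pairingNl.
Qed.

Lemma iterate1 : x 1%N = s 0%N.
Proof.
by have [_ _ _ -> _] := iter; rewrite alpha0 subrr scale0r add0r scale1r.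
Qed.

Lemma bregman_iterates k y (r : R) : f y = r%:E ->
  bregman f df y (x k) = (r - fv k - pairing (u k) (y - x k)%R)%:E.
Proof.
by move=> fy; have [-> _ _ _ _] := iter; rewrite /bregman fy (iterates_f k).1.
Qed.

Lemma curvature_iterates k (a : R) : has_curvature f h df dhs gamma C ->
  (0 <= a <= 1)%R ->
  bregman f df (x k + a *: (s k - x k))%R (x k) <= (C * a `^ gamma / gamma)%:E.
Proof.
move=> f_curv; have [_ sE _ _ xdom] := iter.
by rewrite sE; exact: f_curv (xdom k) (dom_conj_iterates k) a.
Qed.

Lemma curvature_G1 : has_curvature f h df dhs gamma C -> G 1%N <= (C / gamma)%:E.
Proof.
move=> f_curv; have := @curvature_iterates 0%N 1%R f_curv.
by rewrite scale1r addrC subrK powR1 mulr1 -G1 lexx ler01; exact.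
Qed.

(** [C / gamma] bounds the Bregman distance from [x 0] to [s 0], which is nonnegative by
    Fenchel-Young. Its finiteness comes from [s 0 = x 1]. *)
Lemma curvature_const_ge0 : (0 < gamma)%R ->
  has_curvature f h df dhs gamma C -> (0 <= C)%R.
Proof.
move=> g0 /curvature_G1; have fs := (iterates_f 1%N).1.
rewrite iterate1 in fs; rewrite G1 (bregman_iterates 0%N fs) lee_fin pairingBr.
have := fenchel_young f (u 0%N) (s 0%N).
rewrite fs (iterates_f 0%N).2 -EFinB lee_fin /cf => fy Cg.
suff : (0 <= C / gamma)%R by rewrite pmulr_lge0// invr_gt0.
by apply: le_trans Cg; lra.
Qed.

Lemma G_rate n : (1 < gamma)%R -> has_curvature f h df dhs gamma C ->
  (forall k, (1 <= k)%N ->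
    argmin [set a : R | (0 <= a <= 1)%R]
      (fun a => (1 - a)%:E * G k
                + bregman f df (x k + a *: (s k - x k))%R (x k)) (alpha k)) ->
  (forall k, (1 <= k)%N -> G k.+1 = (1 - alpha k)%:E * G k
    + bregman f df ((1 - alpha k) *: x k + alpha k *: s k)%R (x k)) ->
  G n.+1 <= (C * (gamma / (n.+1%:R + gamma)) `^ (gamma - 1))%:E.
Proof.
move=> g1 f_curv line_search GS.
have g0 : (0 < gamma)%R by lra.
have C0 := curvature_const_ge0 g0 f_curv.
elim: n => [|n IHn].
  apply: le_trans (curvature_G1 f_curv) _; rewrite lee_fin ler_wpM2l//.
  (* At [m = 0] the one-step inequality reads [1 / gamma <= (gamma / (1 + gamma)) ^ (gamma - 1)]. *)
  have := @power_rate_step _ gamma 0 g1 (lexx _).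
  by rewrite !add0r divff ?gt_eqF// powR1 mul1r mul1r.
set m : R := n.+1%:R; have m0 : (0 <= m)%R by rewrite ler0n.
(* With this trial step the induction bound is [C * t ^ (gamma - 1)], and the objective is at most
   that bound times [1 - t + t / gamma = (m + 1) / (m + gamma)]. *)
set t := (gamma / (m + gamma))%R.
have mg : (0 < m + gamma)%R by lra.
have t01 : (0 <= t <= 1)%R.
  by rewrite /t divr_ge0 ?(ltW g0) ?(ltW mg)//= ler_pdivrMr// mul1r; lra.
have [_ /(_ t t01)/= Gt] := line_search n.+1 isT.
have xE : ((1 - alpha n.+1) *: x n.+1 + alpha n.+1 *: s n.+1 =
    x n.+1 + alpha n.+1 *: (s n.+1 - x n.+1))%R.
  by rewrite scalerBl scale1r scalerBr -addrA [(- _ + _)%R]addrC.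
rewrite GS// xE; apply: le_trans Gt _.
have /andP[t0 t1] := t01.
apply: (@le_trans _ _ ((1 - t)%:E * (C * t `^ (gamma - 1))%:E
    + (C * t `^ gamma / gamma)%:E)).
  apply: leeD; last exact: curvature_iterates.
  by rewrite lee_wpmul2l// lee_fin subr_ge0.
rewrite -EFinM -EFinD lee_fin -(mulr_powRB1 t0 g0).
have := power_rate_step g1 m0; rewrite -/t -[(n.+2)%:R]natr1 -/m => step.
apply: le_trans (ler_wpM2l C0 step); clearbody m.
rewrite le_eqVlt; apply/orP; left; apply/eqP; rewrite /t.
by field; rewrite (lt0r_neq0 g0) (lt0r_neq0 mg).
Qed.

(** For the averaged choice this is convexity of both conjugates; for the best iterate, a minimum is
    at most a weighted mean. *)
Lemma dual_le k uhat : gcs_weights alpha lam -> (1 <= k)%N ->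
  uhat = (\sum_(i < k) lam k i *: u i)%R \/
  argmin [set u i | i in `I_k]
    (fun v => fenchel_conj f v + fenchel_conj h (- v)%R) uhat ->
  fenchel_conj f uhat + fenchel_conj h (- uhat)%R
    <= (\sum_(i < k) lam k i * (cf i + ch i))%:E.
Proof.
case: k => // n lamw _ uhatP; have [_ _ alpha01 _ _] := iter.
have lam0 (i : 'I_n.+1) := gcs_weights_ge0 lamw alpha01 (ltn_ord i).
have lam1 := gcs_weights_sum1 lamw n alpha0.
have [fp _ _] := f_pcc; have [hp _ _] := h_pcc.
case: uhatP => [->|[_ umin]].
  have -> : (\sum_(i < n.+1) lam n.+1 i * (cf i + ch i) =
      \sum_(i < n.+1) lam n.+1 i * cf i + \sum_(i < n.+1) lam n.+1 i * ch i)%R.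
    by rewrite -big_split; apply: eq_bigr => i _; rewrite mulrDr.
  rewrite EFinD leeD//.
    by apply: fenchel_conj_sum_le => // i; rewrite (iterates_f i).2.
  rewrite -sumrN; under eq_bigr do rewrite -scalerN.
  by apply: fenchel_conj_sum_le => // i; rewrite (iterates_h i).2.
have umin_i (i : 'I_n.+1) :
    fenchel_conj f uhat + fenchel_conj h (- uhat)%R <= (cf i + ch i)%:E.
  rewrite EFinD -(iterates_f i).2 -(iterates_h i).2.
  by apply: umin; exists (i : nat) => //=.
(* An infinite dual value must be treated apart: [-oo] is trivial, and [+oo] contradicts the
   comparison with [u 0]. *)
case E : (_ + _) => [r| |]; last by rewrite leNye.
  rewrite lee_fin -[r]mul1r -lam1 mulr_suml; apply: ler_sum => i _.
  by rewrite ler_wpM2l// -lee_fin -E.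
by have := umin_i ord0; rewrite E.
Qed.

(** The gap estimate is solved for [h (x n.+1)], which is not known to be finite; this real upper
    bound is what [epigraph_convex] takes in the induction. *)
Lemma gap_le_G n :
  (forall k, (1 <= k)%N -> G k.+1 = (1 - alpha k)%:E * G k
    + bregman f df ((1 - alpha k) *: x k + alpha k *: s k)%R (x k)) ->
  gcs_weights alpha lam ->
  exists g : R, G n.+1 = g%:E /\
    h (x n.+1) <=
      (g - fv n.+1 - \sum_(i < n.+1) lam n.+1 i * (cf i + ch i))%:E.
Proof.
move=> GS lamw; have [_ _ alpha01 xS _] := iter.
elim: n => [|n [g [Gn hn]]].
  exists (fv 1%N - fv 0%N - pairing (u 0%N) (s 0%N - x 0%N)%R)%R; split.
    rewrite G1; apply: bregman_iterates.
    by rewrite -iterate1 (iterates_f 1%N).1.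
  rewrite (gcs_weights_sumS lamw _ (fun i => cf i + ch i)%R) big_ord0 alpha0.
  rewrite iterate1 (iterates_h 0%N).1 lee_fin pairingBr /cf /ch.
  lra.
set a := alpha n.+1; have fE := (iterates_f n.+2).1.
exists ((1 - a) * g + (fv n.+2 - fv n.+1
  - pairing (u n.+1) (x n.+2 - x n.+1)%R))%R; split.
  by rewrite GS// Gn -xS (bregman_iterates n.+1 fE) -EFinM -EFinD.
have /andP[a0 a1] := alpha01 n.+1.
have a01 : (0 <= 1 - a <= 1)%R by rewrite /a; lra.
have hs : h (s n.+1) <= (hv n.+1)%:E by rewrite (iterates_h n.+1).1.
have := epigraph_convex h_pcc a01 hn hs; rewrite subKr -xS => /le_trans; apply.
have -> : (x n.+2 - x n.+1 = a *: (s n.+1 - x n.+1))%R.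
  by rewrite xS scalerBl scale1r scalerBr addrAC [(x n.+1 - _)%R]addrC addrK addrC.
rewrite (gcs_weights_sumS lamw n.+1 (fun i => cf i + ch i)%R) lee_fin.
rewrite pairingZr pairingBr -/a {2 3}/cf {2 3}/ch.
set S := (\sum_(i < n.+1) _)%R.
(* Convexity of [h] is the only loss besides the induction hypothesis; what remains is an
   identity. *)
rewrite le_eqVlt; apply/orP; left; apply/eqP; rewrite /cf /ch.
ring.
Qed.

End ConditionalSubgradient.

Theorem theorem3 (R : realType) (X : vectType R) (f h : X -> \bar R)
    (df : X -> 'Hom(X, R^o)) (dhs : 'Hom(X, R^o) -> X)
    (gamma C : R) (alpha : nat -> R) (x : nat -> X) (u : nat -> 'Hom(X, R^o))
    (s : nat -> X) (G : nat -> \bar R) (lam : nat -> nat -> R)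
    (f_pcc : proper_closed_convex f) (h_pcc : proper_closed_convex h)
    (df_oracle : subgrad_oracle f df)
    (dhs_oracle : subgrad_conj_oracle h dhs)
    (df_dhs : compatible_oracles f h df dhs)
    (gamma_gt1 : (1 < gamma)%R)
    (f_curv : has_curvature f h df dhs gamma C)
    (iter : gcs_iterates f df dhs alpha x u s)
    (alpha0 : alpha 0%N = 1%R)
    (line_search : forall k, (1 <= k)%N ->
      argmin [set a : R | (0 <= a <= 1)%R]
        (fun a => (1 - a)%:E * G k
                  + bregman f df (x k + a *: (s k - x k))%R (x k))
        (alpha k))
    (G1 : G 1%N = bregman f df (s 0%N) (x 0%N))
    (GS : forall k, (1 <= k)%N ->
      G k.+1 = (1 - alpha k)%:E * G k
        + bregman f df ((1 - alpha k) *: x k + alpha k *: s k)%R (x k))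
    (lam_weights : gcs_weights alpha lam)
    (k : nat) (k_ge1 : (1 <= k)%N) (uhat : 'Hom(X, R^o))
    (uhat_choice :
      uhat = (\sum_(i < k) lam k i *: u i)%R \/
      argmin [set u i | i in `I_k]
        (fun v => fenchel_conj f v + fenchel_conj h (- v)%R) uhat) :
  f (x k) + h (x k) + fenchel_conj f uhat + fenchel_conj h (- uhat)%R
    <= (C * (gamma / (k%:R + gamma)) `^ (gamma - 1))%:E.
Proof.
case: k k_ge1 uhat_choice => // n n1 uhat_choice.
have dual := dual_le f_pcc h_pcc df_oracle dhs_oracle df_dhs iter alpha0
  lam_weights n1 uhat_choice.
have [g [Gn hn]] := gap_le_G f_pcc h_pcc df_oracle dhs_oracle df_dhs iter
  alpha0 G1 n GS lam_weights.
have := G_rate f_pcc df_oracle df_dhs iter alpha0 G1 n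
  gamma_gt1 f_curv line_search GS.
rewrite Gn; apply: le_trans; rewrite -addeA.
apply: le_trans (leeD (leeD (lexx _) hn) dual) _.
rewrite (iterates_f f_pcc df_oracle iter n.+1).1 -!EFinD lee_fin.
lra.
Qed.
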